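(* Let $V$ be a finite-dimensional real vector space with $\dim V\ge 2$, with a symmetric invertible metric tensor $g$ of arbitrary signature. Let $R,S,P\in V$ be nonzero vectors with $R^2=S^2\neq 0$, $(S+R)^2\neq 0$, $(R-S)^2\neq0$, $P\cdot(R+S)\neq 0$, $P\wedge(R-S)\neq0$ and $P^2(R-S)^2+4(P\cdot R)(P\cdot S)\neq 0$, and set $$\mu=\frac{2P\cdot(R+S)}{\{P\wedge(R-S)\}^2+\{P\cdot(R+S)\}^2}.$$ If $P$ is coplanar with $R,S$, i.e. $P\wedge R\wedge S=0$, then $$(\mu P)\wedge(R-S)=\frac{S\wedge R}{S^2}.$$ That is, when the preferred ray $P$ is coplanar relative to $R\wedge S$, the bivector $(\mu P)\wedge(R-S)$ generating the pure isometry-link from $R$ to $S$ is determined uniquely by $R$ and $S$.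
   Context: Notation: $A\cdot B=g(A,B)$, $A^2=A\cdot A$, and $(A\wedge B)^2=A^2B^2-(A\cdot B)^2$. Since $R^2=S^2$, the denominator of $\mu$ equals $P^2(R-S)^2+4(P\cdot R)(P\cdot S)$. An isometry-link from $R$ to $S$ is a $g$-isometry $L$ with $LR=S$; under the stated hypotheses the isometry-links generated by simple bivectors are generated by the bivectors $(\mu P)\wedge(R-S)$. *)

(* Defs.v *)
From HB Require Import structures.
From mathcomp Require Import all_boot all_order all_algebra.
From mathcomp Require Import functions reals.

Set Implicit Arguments.
Unset Strict Implicit.
Unset Printing Implicit Defensive.

Import Order.TTheory GRing.Theory Num.Theory.
Local Open Scope ring_scope.

(* A decomposable k-vector u_0 /\ ... /\ u_(k-1) of V is encoded as the
   alternating k-linear form (a_0, ..., a_(k-1)) |-> det (a_i (u_j)) on the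
   dual of V.  For V finite-dimensional this identifies the k-th exterior power
   of V with the alternating k-linear forms on the dual of V; k-vectors are
   added and scaled pointwise. *)
Definition wedge (K : fieldType) (V : vectType K) (k : nat) (u : k.-tuple V) :
    k.-tuple 'Hom(V, K^o) -> K^o :=
  fun a => \det (\matrix_(i < k, j < k) (tnth a i (tnth u j) : K)).

Definition wedge2 (K : fieldType) (V : vectType K) (A B : V) :=
  wedge [tuple A; B].

Definition wedge3 (K : fieldType) (V : vectType K) (A B C : V) :=
  wedge [tuple A; B; C].

Section Link.
Variables (K : realType) (V : vectType K) (g : {symmetric V}).

Definition sq (A : V) : K := g A A.

(* The square (A /\ B)^2 of a simple bivector. *)
Definition wedge2_sq (A B : V) : K := sq A * sq B - g A B ^+ 2.

Definition mu (R S P : V) : K :=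
  2 * g P (R + S) / (wedge2_sq P (R - S) + g P (R + S) ^+ 2).

Definition preferred (R S P : V) : Prop :=
  [/\ P != 0, g P (R + S) != 0, wedge2 P (R - S) <> 0
    & sq P * sq (R - S) + 4 * g P R * g P S != 0].

Definition coplanar (R S P : V) : Prop := wedge3 P R S = 0.

End Link.

(* Main.v *)
(** The invertibility of [(R + S)^2] and [(R - S)^2] makes the Gram determinant
    [(R /\ S)^2] nonzero, so a coplanar [P] is a combination [x R + y S].  Then
    [P /\ (R - S) = (x + y) (S /\ R)], while [P . (R + S) = (x + y) (S^2 + R . S)]
    and the denominator of [mu] is [2 S^2 (S^2 + R . S) (x + y)^2]; hence
    [mu (x + y) = 1 / S^2] whatever [x] and [y] are. *)
Require Import Defs.
From HB Require Import structures.
From mathcomp Require Import all_boot all_order all_algebra.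
From mathcomp Require Import functions reals.
From mathcomp Require Import boolp ring.

Set Implicit Arguments.
Unset Strict Implicit.
Unset Printing Implicit Defensive.

Import Order.TTheory GRing.Theory Num.Theory.
Local Open Scope ring_scope.

(** The coordinate functions of a basis are themselves linear forms, and they determine a vector. *)
Lemma dual_separates (K : fieldType) (V : vectType K) (u v : V) :
  (forall f : 'Hom(V, K^o), f u = f v) -> u = v.
Proof.
move=> fuv; rewrite (coord_vbasis (memvf u)) (coord_vbasis (memvf v)).
apply: eq_bigr => i _; congr (_ *: _).
by have := fuv (linfun (coord (vbasis {:V}) i : V -> K^o)); rewrite !lfunE.
Qed.

Lemma det_mx22 (K : comNzRingType) (M : 'M[K]_2) :
  \det M = M 0 0 * M 1 1 - M 0 1 * M 1 0.
Proof.
rewrite (expand_det_row _ 0) !big_ord_recl big_ord0 /cofactor !det_mx11 !mxE.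
have -> : lift 0 0 = 1 :> 'I_2 by apply/val_inj.
have -> : lift 1 0 = 0 :> 'I_2 by apply/val_inj.
by rewrite /= expr0 expr1; ring.
Qed.

Lemma det_mx33 (K : comNzRingType) (M : 'M[K]_3) (o : 'I_3 := 0)
    (i : 'I_3 := 1) (t : 'I_3 := inord 2) :
  \det M = M o o * (M i i * M t t - M i t * M t i)
    - M o i * (M i o * M t t - M i t * M t o)
    + M o t * (M i o * M t i - M i i * M t o).
Proof.
rewrite (expand_det_row _ 0) !big_ord_recl big_ord0 /cofactor !det_mx22 !mxE.
(* Cofactor expansion leaves indices written with [lift]; each is identified with one of [o], [i],
   [t]. *)
have lift00 : lift 0 0 = i by apply/val_inj.
have lift01 : lift 0 1 = t by apply/val_inj; rewrite /= inordK.
have lift10 : lift i 0 = o by apply/val_inj.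
have lift11 : lift i 1 = t by apply/val_inj; rewrite /= inordK.
have lift20 : lift t 0 = o by apply/val_inj; rewrite /= /bump inordK.
have lift21 : lift t 1 = i by apply/val_inj; rewrite /= /bump inordK.
have lift0 : lift 0 (lift 0 0) = t :> 'I_3
  by apply/val_inj; rewrite /= inordK.
rewrite lift0 lift00 lift01 lift10 lift11 lift20 lift21 /=.
by rewrite inordK //= -/o; ring.
Qed.

Lemma wedge2E (K : fieldType) (V : vectType K) (A B : V)
    (a : 2.-tuple 'Hom(V, K^o)) :
  wedge2 A B a = (tnth a 0 A : K) * tnth a 1 B - (tnth a 0 B : K) * tnth a 1 A.
Proof. by rewrite /wedge2 /wedge det_mx22 !mxE. Qed.

Lemma wedge3E (K : fieldType) (V : vectType K) (A B C : V)
    (f0 f1 f2 : 'Hom(V, K^o)) :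
  wedge3 A B C [tuple f0; f1; f2] =
    (f0 A : K) * ((f1 B : K) * f2 C - (f1 C : K) * f2 B)
    - (f0 B : K) * ((f1 A : K) * f2 C - (f1 C : K) * f2 A)
    + (f0 C : K) * ((f1 A : K) * f2 B - (f1 B : K) * f2 A).
Proof.
by rewrite /wedge3 /wedge det_mx33 !mxE !(tnth_nth 0) /= inordK.
Qed.

Section Link.
Variables (K : realType) (V : vectType K) (g : {symmetric V}).
Implicit Types A B C R S P : V.

Lemma symm A B : g A B = g B A.
Proof. by rewrite hermC /= expr0 mul1r. Qed.

Lemma coplanar_lincomb R S P :
  wedge2_sq g R S != 0 -> coplanar R S P -> exists x y, P = x *: R + y *: S.
Proof.
rewrite /wedge2_sq /sq => gram_neq0 cop.
set gram := (X in X != 0) in gram_neq0.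
(* The coefficients solve the Gram system obtained by pairing [P = x *: R + y *: S] with [R] and
   with [S]. *)
exists ((g R P * g S S - g S P * g R S) / gram).
exists ((g S P * g R R - g R P * g R S) / gram).
(* Contracting P /\ R /\ S with f, g R and g S gives Cramer's rule for f P. *)
apply: dual_separates => f.
have := congr1 (fun F => F [tuple f; linfun (g R : V -> K^o);
  linfun (g S : V -> K^o)]) cop.
rewrite wedge3E !lfunE /= (symm S R) => cop_f.
rewrite linearD !linearZ /=; apply: (mulIf gram_neq0).
(* The difference of the two sides is exactly the contracted trivector, so that 0 is traded for
   it. *)
apply/eqP; rewrite -subr_eq0 -[X in _ == X]cop_f; apply/eqP.
rewrite /gram in gram_neq0 *.
by rewrite /GRing.scale/=; field.
Qed.

Lemma wedge2_mu_coplanar R S P :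
    sq g R = sq g S -> sq g S != 0 -> sq g (S + R) != 0 -> sq g (R - S) != 0 ->
    g P (R + S) != 0 -> coplanar R S P ->
  wedge2 (mu g R S P *: P) (R - S) = (sq g S)^-1 *: wedge2 S R.
Proof.
move=> eqRS S0 pRS0 mRS0 gP0 cop.
have [x [y defP]] : exists x y, P = x *: R + y *: S.
  apply: coplanar_lincomb cop; apply: contraNneq (mulf_neq0 pRS0 mRS0) => gram0.
  (* With [R^2 = S^2 = s] and [R . S = c], this reads [(2s + 2c)(2s - 2c) = 4(s^2 - c^2)]. *)
  have -> : sq g (S + R) * sq g (R - S) = 4 * wedge2_sq g R S.
    move: eqRS; rewrite /wedge2_sq /sq !(linearBl, linearB, linearDl, linearD) /=.
    by rewrite (symm S R) => ->; ring.
  by rewrite gram0 mulr0.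
move: eqRS S0 => + +; rewrite /sq; set s := g S S; set c := g R S => eqRS s0.
have gPl A : g P A = x * g R A + y * g S A.
  by rewrite defP linearDl /= !linearZl_LR.
have gPR : g P R = x * s + y * c by rewrite gPl eqRS (symm S R).
have gPS : g P S = x * c + y * s by rewrite gPl.
have gPP : g P P = x * g P R + y * g P S by rewrite gPl !(symm _ P).
have gPRS : g P (R + S) = (x + y) * (s + c).
  by rewrite linearD /= gPR gPS; ring.
(* Both factors of [P . (R + S)] are nonzero; together with [s] they are the factors of the
   denominator of [mu], up to the constant 2. *)
move: gP0; rewrite gPRS mulf_eq0 negb_or => /andP[xy0 sc0].
have muE : mu g R S P * (x + y) = s^-1.
  rewrite /mu; have -> : wedge2_sq g P (R - S) + g P (R + S) ^+ 2
                         = 2 * s * (s + c) * (x + y) ^+ 2.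
    rewrite gPRS /wedge2_sq /sq !(linearBl, linearB) /= gPP gPR gPS eqRS (symm S R).
    by rewrite -/s -/c; ring.
  by rewrite gPRS; field; rewrite s0 sc0 xy0.
(* Writing [1 / S^2] as [mu (x + y)] leaves a polynomial identity in which [mu] is an atom; folding
   [defP] back restores [P] inside [mu]. *)
apply/funext => a; rewrite -[RHS]/(_ * wedge2 S R a) -muE !wedge2E.
by rewrite defP !(linearB, linearZ, linearD) /= -defP /GRing.scale /=; ring.
Qed.

End Link.

Theorem mainTheorem3 (K : realType) (V : vectType K) (g : {symmetric V})
    (dimV : (2 <= \dim {:V})%N) (g_invertible : nondegenerate g)
    (R S P : V) (R_neq0 : R != 0) (S_neq0 : S != 0)
    (RS_sq : sq g R = sq g S) (S_sq_neq0 : sq g S != 0)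
    (addSR_sq_neq0 : sq g (S + R) != 0) (subRS_sq_neq0 : sq g (R - S) != 0)
    (P_preferred : preferred g R S P) (P_coplanar : coplanar R S P) :
  wedge2 (mu g R S P *: P) (R - S) = (sq g S)^-1 *: wedge2 S R /\
  (forall P' : V, preferred g R S P' -> coplanar R S P' ->
    wedge2 (mu g R S P' *: P') (R - S) = wedge2 (mu g R S P *: P) (R - S)).
Proof.
have [_ gP0 _ _] := P_preferred.
split=> [|P' [_ gP'0 _ _] P'_coplanar]; first exact: wedge2_mu_coplanar.
(* Both bivectors equal the same multiple of [S /\ R], in which neither [P] nor [P'] occurs. *)
by rewrite !wedge2_mu_coplanar.
Qed.
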